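(* Let $\mathbf A=(A,\le,0,1)$ be a bounded MLUB-complete poset, $(T,R)$ a time frame with $R$ a serial binary relation, and $P,F,H,G$ the tense operators on $\mathbf A$ induced by $(T,R)$. Let $R^*$ be the relation induced by $P,F,H,G$, and $P^*,F^*,H^*,G^*$ the tense operators on $\mathbf A$ induced by $(T,R^* )$. Then $R\subseteq R^*$ and $P^*=P$, $F^*=F$, $H^*=H$, $G^*=G$.
   Context: For a poset and $X\subseteq A$: $L(X)$, $U(X)$ are the sets of lower/upper bounds of $X$; $\operatorname{Max}X,\operatorname{Min}X$ the sets of maximal/minimal elements. MLUB-complete: for every nonempty $M\subseteq A$, every upper bound of $M$ lies above some minimal upper bound of $M$ and every lower bound lies below some maximal lower bound. $\mathcal P_+(X)$ = nonempty subsets of $X$. For subsets $X,Y$, $X\le Y$ iff $x\le y$ for all $x\in X,y\in Y$. A time frame is $(T,R)$ with $T\ne\emptyset$, $R$ a binary relation on $T$; serial: each $s$ has $r,t$ with $rRs$, $sRt$. For $B\subseteq A^T$, $B(t)=\{q(t)\mid q\in B\}$. Tense operators induced by a time frame $(T,R)$ are the maps $P,F,H,G:\mathcal P_+(A^T)\to(\mathcal P_+A)^T$ with $P(B)(s)=\operatorname{Min}U(\{q(t)\mid q\in B, tRs\})$, $F(B)(s)=\operatorname{Min}U(\{q(t)\mid q\in B, sRt\})$, $H(B)(s)=\operatorname{Max}L(\{q(t)\mid q\in B, tRs\})$, $G(B)(s)=\operatorname{Max}L(\{q(t)\mid q\in B, sRt\})$. The relation induced by maps $P,F,H,G$ is $R^*=\{(s,t)\in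 T^2\mid H(B)(t)\le B(s)\le P(B)(t)\text{ and }G(B)(s)\le B(t)\le F(B)(s)\text{ for all }B\in\mathcal P_+(A^T)\}$. *)

(* Defs.v *)
From mathcomp Require Import all_boot all_order.
From mathcomp Require Import boolp classical_sets.

Set Implicit Arguments.
Unset Strict Implicit.
Unset Printing Implicit Defensive.

Import Order.TTheory.
Local Open Scope order_scope.
Local Open Scope classical_set_scope.

Record nset (U : Type) := NSet {
  nset_set :> set U;
  nset_neq0 : nset_set !=set0 }.

Section Poset.
Context {d : Order.disp_t} {A : porderType d}.
Implicit Types X Y M : set A.

Definition Max X : set A := [set x | X x /\ forall y, X y -> x <= y -> y = x].
Definition Min X : set A := [set x | X x /\ forall y, X y -> y <= x -> y = x].

Definition set_le X Y : Prop := forall x y, X x -> Y y -> x <= y.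

End Poset.

Definition MLUB_complete (d : Order.disp_t) (A : porderType d) : Prop :=
  forall M : set A, M !=set0 ->
    (forall u, ubound M u -> exists2 m, Min (ubound M) m & m <= u) /\
    (forall l, lbound M l -> exists2 m, Max (lbound M) m & l <= m).

Definition serial (T : Type) (R : set (T * T)) : Prop :=
  forall s, exists r t, R (r, s) /\ R (s, t).

Section Nonempty.
Context {d : Order.disp_t} {A : tbPOrderType d}.
Hypothesis hA : MLUB_complete A.

(* For M empty these are {\bot} and {\top}: no seriality is needed for the
   tense operators below to take values in the nonempty subsets. *)
Lemma Min_ubound_neq0 (M : set A) : Min (ubound M) !=set0.
Proof.
have [M0|/nonemptyPn->] := pselect (M !=set0).
  by have [m mM _] := (hA M0).1 \top (fun x _ => lex1 x); exists m.
by exists \bot; split=> // y _; rewrite lex0 => /eqP.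
Qed.

Lemma Max_lbound_neq0 (M : set A) : Max (lbound M) !=set0.
Proof.
have [M0|/nonemptyPn->] := pselect (M !=set0).
  by have [m mM _] := (hA M0).2 \bot (fun x _ => le0x x); exists m.
by exists \top; split=> // y _; rewrite le1x => /eqP.
Qed.

Definition MinU (M : set A) : nset A := NSet (Min_ubound_neq0 M).
Definition MaxL (M : set A) : nset A := NSet (Max_lbound_neq0 M).

End Nonempty.

Definition tense_op (T A : Type) := nset (T -> A) -> T -> nset A.

Section Tense.
Context {d : Order.disp_t} {A : tbPOrderType d} (hA : MLUB_complete A).
Context {T : Type} (R : set (T * T)).

Definition past_values (B : set (T -> A)) (s : T) : set A :=
  [set a | exists q t, [/\ B q, R (t, s) & a = q t]].
Definition future_values (B : set (T -> A)) (s : T) : set A :=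
  [set a | exists q t, [/\ B q, R (s, t) & a = q t]].

Definition tenseP : tense_op T A := fun B s => MinU hA (past_values B s).
Definition tenseF : tense_op T A := fun B s => MinU hA (future_values B s).
Definition tenseH : tense_op T A := fun B s => MaxL hA (past_values B s).
Definition tenseG : tense_op T A := fun B s => MaxL hA (future_values B s).

End Tense.

Definition values_at (T A : Type) (B : set (T -> A)) (t : T) : set A :=
  [set q t | q in B].

Definition induced_rel (d : Order.disp_t) (A : porderType d) (T : Type)
    (P F H G : tense_op T A) : set (T * T) :=
  [set st | forall B : nset (T -> A),
     [/\ set_le (H B st.2) (values_at B st.1),
         set_le (values_at B st.1) (P B st.2),
         set_le (G B st.1) (values_at B st.2) &
         set_le (values_at B st.2) (F B st.1)]].

(* Main.v *)
(** Minimal upper bounds of [M] are upper bounds, so [R] is contained in the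
    induced relation [R*], and the value sets grow when [R] is replaced by [R*].
    By definition of [R*], the new values still lie below every element of
    [Min (ubound M)]; MLUB-completeness puts such an element below any upper
    bound of [M], so the set of upper bounds, and hence its minimal elements,
    does not change. Dually for lower bounds. *)

Require Import Defs.
From mathcomp Require Import all_boot all_order.
From mathcomp Require Import boolp classical_sets.
Local Open Scope classical_set_scope.

Import Order.TTheory.

(** Nonemptiness proofs are irrelevant, so operator values can be compared as plain sets. *)
Lemma nset_inj (U : Type) (X Y : nset U) : nset_set X = nset_set Y -> X = Y.
Proof.
by case: X Y => [X X0] [Y Y0] /= XY; subst Y; rewrite (Prop_irrelevance X0 Y0).
Qed.

Section MinMaxBounds.
Context {d : Order.disp_t} {A : tbPOrderType d} (hA : MLUB_complete A).
Implicit Types M N : set A.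

(** Both sets have the same upper bounds; nonemptiness of [M] lets MLUB-completeness apply to it. *)
Lemma MinU_eq M N : M !=set0 -> M `<=` N -> set_le N (MinU hA M) ->
  MinU hA N = MinU hA M.
Proof.
move=> M0 MN leN; apply: nset_inj => /=; congr Min.
apply/seteqP; split=> u uM x; first by move/MN; exact: uM.
(* [m] interpolates: every element of [N] is below [m], and [m] is below [u]. *)
have [m mM mu] := (hA M M0).1 u uM.
by move=> Nx; exact: le_trans (leN _ _ Nx mM) mu.
Qed.

Lemma MaxL_eq M N : M !=set0 -> M `<=` N -> set_le (MaxL hA M) N ->
  MaxL hA N = MaxL hA M.
Proof.
move=> M0 MN leN; apply: nset_inj => /=; congr Max.
apply/seteqP; split=> l lM x; first by move/MN; exact: lM.
have [m mM lm] := (hA M M0).2 l lM.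
by move=> Nx; exact: le_trans lm (leN _ _ mM Nx).
Qed.

End MinMaxBounds.

Section Values.
Context {d : Order.disp_t} {A : tbPOrderType d} (hA : MLUB_complete A).
Context {T : Type}.
Implicit Types (R S : set (T * T)) (B : nset (T -> A)).

(** Seriality supplies a predecessor of [s], at which a member of [B] takes a value. *)
Lemma past_values_neq0 R B s : serial R -> @past_values d A T R B s !=set0.
Proof.
move=> hR; have [q Bq] := nset_neq0 B; have [r [_ [Rrs _]]] := hR s.
by exists (q r), q, r.
Qed.

Lemma future_values_neq0 R B s : serial R -> @future_values d A T R B s !=set0.
Proof.
move=> hR; have [q Bq] := nset_neq0 B; have [_ [t [_ Rst]]] := hR s.
by exists (q t), q, t.
Qed.

Lemma past_values_subset R S B s : R `<=` S ->
  @past_values d A T R B s `<=` past_values S B s.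
Proof. by move=> RS _ [q [t [Bq Rts ->]]]; exists q, t; split=> //; exact: RS. Qed.

Lemma future_values_subset R S B s : R `<=` S ->
  @future_values d A T R B s `<=` future_values S B s.
Proof. by move=> RS _ [q [t [Bq Rst ->]]]; exists q, t; split=> //; exact: RS. Qed.

(** When [R] relates [s] to [t], values at [s] are past values for [t] and values at [t] are future
    values for [s], so the bounds apply to them. *)
Lemma subset_induced_rel R :
  R `<=` induced_rel (tenseP hA R) (tenseF hA R) (tenseH hA R) (tenseG hA R).
Proof.
move=> [s t] Rst B; split=> /=.
- by move=> x _ [xL _] [q Bq <-]; apply: xL; exists q, s.
- by move=> _ y [q Bq <-] [yU _]; apply: yU; exists q, s.
- by move=> x _ [xL _] [q Bq <-]; apply: xL; exists q, t.
- by move=> _ y [q Bq <-] [yU _]; apply: yU; exists q, t.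
Qed.

End Values.

Theorem theorem5p4 (d : Order.disp_t) (A : tbPOrderType d)
    (hA : MLUB_complete A) (T : Type) (hT : [set: T] !=set0)
    (R : set (T * T)) (hR : serial R) :
  let P := tenseP hA R in
  let F := tenseF hA R in
  let H := tenseH hA R in
  let G := tenseG hA R in
  let Rstar := induced_rel P F H G in
  R `<=` Rstar /\
  [/\ tenseP hA Rstar = P, tenseF hA Rstar = F,
      tenseH hA Rstar = H & tenseG hA Rstar = G].
Proof.
move=> P F H G Rstar.
have RRs : R `<=` Rstar by exact: subset_induced_rel.
split=> //; split; apply/funext => B; apply/funext => s.
- apply: MinU_eq (past_values_neq0 _ _ _ hR) (past_values_subset _ _ _ _ RRs) _.
  (* Membership of [(t, s)] in [Rstar] is used at this same [B]: its clause for [P] puts [q t] below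
     [m]. *)
  move=> _ m [q [t [Bq Rts ->]]] mP; have [_ leP _ _] := Rts B.
  by apply: leP mP; exists q.
- apply: MinU_eq (future_values_neq0 _ _ _ hR) (future_values_subset _ _ _ _ RRs) _.
  move=> _ m [q [t [Bq Rst ->]]] mF; have [_ _ _ leF] := Rst B.
  by apply: leF mF; exists q.
- apply: MaxL_eq (past_values_neq0 _ _ _ hR) (past_values_subset _ _ _ _ RRs) _.
  move=> m _ mH [q [t [Bq Rts ->]]]; have [leH _ _ _] := Rts B.
  by apply: leH mH _; exists q.
- apply: MaxL_eq (future_values_neq0 _ _ _ hR) (future_values_subset _ _ _ _ RRs) _.
  move=> m _ mG [q [t [Bq Rst ->]]]; have [_ _ leG _] := Rst B.
  by apply: leG mG _; exists q.
Qed.
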